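(* For each integer $j\geq 3$, there are infinitely many pairs $(\lambda,\mu)$ of distinct partitions $\lambda\neq\mu$, both of length $2j$, such that $|\lambda| = |\mu|$ and $\mathrm{pre}_j(\lambda) = \mathrm{pre}_j(\mu)$.
   Context: A partition $\lambda=(\lambda_1,\ldots,\lambda_\ell)$ is a weakly decreasing finite sequence of positive integers; its length is $\ell$ and its size is $|\lambda|=\lambda_1+\cdots+\lambda_\ell$. A partition is identified with its multiset of parts. For $1\le j\le \ell$, $\mathrm{pre}_j(\lambda)$ is the partition whose multiset of parts is $\{\!\{\lambda_{i_1}\cdots\lambda_{i_j} : 1\le i_1<i_2<\cdots<i_j\le \ell\}\!\}$ (one part for each $j$-element subset of indices). *)

(* Defs.v *)
From HB Require Import structures.
From mathcomp Require Import all_boot.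

Set Implicit Arguments.
Unset Strict Implicit.
Unset Printing Implicit Defensive.

Definition is_intpart (s : seq nat) : bool := sorted geq s && all (leq 1) s.

Record intpart := IntPart {
  parts :> seq nat;
  _ : is_intpart parts
}.

HB.instance Definition _ := [isSub for parts].
HB.instance Definition _ := [Countable of intpart by <:].

Definition psize (lam : intpart) : nat := \sum_(k <- lam) k.

(* Parts are indexed from 0, and the image list of the [j]-subsets of indices
   keeps repetitions: each subset contributes one entry. *)
Definition pre_products (j : nat) (lam : seq nat) : seq nat :=
  [seq \prod_(i in A) nth 0 lam i
     | A : {set 'I_(size lam)} in [set A : {set 'I_(size lam)} | #|A| == j]].

Lemma pre_subproof (j : nat) (lam : intpart) :
  is_intpart (sort geq (pre_products j lam)).
Proof.
case: lam => s /= /andP[_ /allP s_gt0].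
rewrite /is_intpart sort_sorted /=; last by move=> m n; apply: leq_total.
apply/allP => k; rewrite mem_sort => /mapP[A _ ->].
by rewrite prodn_gt0 // => i; apply/s_gt0/mem_nth.
Qed.

Definition pre (j : nat) (lam : intpart) : intpart :=
  IntPart (pre_subproof j lam).

(* Main.v *)
Require Import Defs.
From mathcomp Require Import all_boot.
From mathcomp Require Import classical_sets cardinality.
From mathcomp Require Import zify.

(** If s_i * r_i = c for 2j pairs and the product of the s_i is c^j, then each
    j-fold product of the s_i equals the product of the r_i over the
    complementary indices, so s and r have the same multiset of j-fold products.
    For j = 3 and c = 160 the lists 32,32,10,10,10,4 and 40,16,16,16,5,5 satisfy
    this and both have sum 98.  Adjoining j - 3 copies of the parts 160 and 1 to
    both lists gives a solution for j, and scaling it gives infinitely many. *)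

Local Open Scope classical_set_scope.

(** [pre_products] indexes by a type that depends on the list; this gives two lists of equal length
    the common index type ['I_n]. *)
Lemma pre_productsE (j n : nat) (s : seq nat) : size s = n ->
  pre_products j s =
  [seq \prod_(i in A) nth 0 s i
     | A : {set 'I_n} in finset (fun A : {set 'I_n} => #|A| == j)].
Proof. by move=> <-. Qed.

(* [rev r] because lists of parts are decreasing, while [x |-> c / x] reverses
   the order. *)
Lemma perm_pre_products (j c : nat) (s r : seq nat) :
  0 < c -> size s = 2 * j -> size r = 2 * j ->
  all2 (fun x y => x * y == c) s (rev r) -> \prod_(x <- s) x = c ^ j ->
  perm_eq (pre_products j s) (pre_products j r).
Proof.
move=> c_gt0 sz_s sz_r sr prod_s.
have srE (i : 'I_(2 * j)) : nth 0 s i * nth 0 r (rev_ord i) = c.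
  move: sr; rewrite all2E size_rev sz_s sz_r eqxx /= => /allP sr.
  apply/eqP; apply: (sr (nth 0 s i, nth 0 r (rev_ord i))).
  have -> : nth 0 r (rev_ord i) = nth 0 (rev r) i.
    by rewrite nth_rev ?sz_r.
  rewrite -nth_zip ?size_rev ?sz_s ?sz_r //.
  by apply: mem_nth; rewrite size_zip size_rev sz_s sz_r minnn.
(* [rev_ord] mirrors the reversal of [r]: [h A] holds the positions in [r] of the partners of the
   entries of [s] outside [A]. *)
pose h (A : {set 'I_(2 * j)}) : {set 'I_(2 * j)} := @rev_ord (2 * j) @^-1: ~: A.
have h_inj : injective h.
  move=> A B /setP hAB; apply/setP => i.
  by move: (hAB (rev_ord i)); rewrite !inE rev_ordK => /negb_inj.
have card_h (A : {set 'I_(2 * j)}) : #|A| = j -> #|h A| = j.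
  move=> cA; rewrite card_preimset; last exact: rev_ord_inj.
  by rewrite cardsCs finset.setCK card_ord cA mul2n -addnn addnK.
rewrite (pre_productsE _ _ s sz_s) (pre_productsE _ _ r sz_r) /image_mem.
set P := mem _.
have -> : [seq \prod_(i in A) nth 0 s i | A : {set 'I_(2 * j)} <- enum P] =
          [seq \prod_(i in A) nth 0 r i
             | A : {set 'I_(2 * j)} <- [seq h A | A <- enum P]].
  rewrite -map_comp; apply/eq_in_map => A; rewrite mem_enum inE => /eqP cA /=.
  rewrite [RHS](reindex_inj rev_ord_inj) /=.
  under [RHS]eq_bigl => i do rewrite !inE rev_ordK.
  have prod_C : \prod_(i | i \notin A) nth 0 s i *
                \prod_(i | i \notin A) nth 0 r (rev_ord i) = c ^ j.
    rewrite -big_split /=; under eq_bigr => i _ do rewrite srE.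
    rewrite prod_nat_const; congr (c ^ _).
    have : #|[predC A]| = j.
      by apply: (@addnI #|A|); rewrite cardC card_ord cA mul2n addnn.
    by apply: etrans; apply: eq_card => i; rewrite !inE.
  have sC_gt0 : 0 < \prod_(i | i \notin A) nth 0 s i.
    apply: prodn_cond_gt0 => i _.
    by move: c_gt0; rewrite -(srE i) muln_gt0 => /andP[].
  (* Multiplied by the product of [s] over the complement of [A], both sides become [c ^ j]. *)
  apply/eqP; rewrite -(eqn_pmul2l sC_gt0) prod_C -prod_s mulnC.
  by rewrite (big_nth 0) big_mkord sz_s [X in _ == X](bigID (mem A)).
apply: perm_map; apply: uniq_perm; first by rewrite map_inj_uniq ?enum_uniq.
  exact: enum_uniq.
(* An injective map of the finite family of [j]-subsets into itself is onto, so [h] only permutes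
   the enumeration. *)
apply: (fun u v w => (@uniq_min_size _ _ _ u v w).2).
- by rewrite map_inj_uniq ?enum_uniq.
- move=> _ /mapP[A + ->]; rewrite !mem_enum !inE => /eqP /card_h ->.
  exact: eqxx.
- by rewrite size_map.
Qed.

Lemma pre_eq (j : nat) (lam mu : intpart) :
  perm_eq (pre_products j lam) (pre_products j mu) -> pre j lam = pre j mu.
Proof.
move=> peq; apply: val_inj => /=; apply/perm_sortP => //.
- by move=> m n; apply: leq_total.
- by move=> m n p /= mn /leq_trans; apply.
- by move=> m n; rewrite andbC -eqn_leq => /eqP.
Qed.

(** With the 160s in front and the 1s at the back, the list stays decreasing and [rev] brings each
    160 opposite a 1. *)
Definition pad (k : nat) (a : seq nat) : seq nat := nseq k 160 ++ a ++ nseq k 1.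

Lemma is_intpart_pad (k : nat) (a : seq nat) :
  is_intpart a -> all (fun x => x <= 160) a -> is_intpart (pad k a).
Proof.
have geq_trans : transitive geq by move=> m n p /= mn /leq_trans; apply.
have sorted_nseq m x : sorted geq (nseq m x).
  by case: m => //= m; elim: m => //= m ->; rewrite leqnn.
move=> /andP[a_sorted /allP a_gt0] /allP a_le; apply/andP; split; last first.
  rewrite !all_cat; apply/and3P; split; last by apply/allP => x /nseqP[->].
    by apply/allP => x /nseqP[->].
  exact/allP.
move: a_sorted (sorted_nseq k 160) (sorted_nseq k 1).
rewrite !(sorted_pairwise geq_trans) !pairwise_cat => -> -> ->.
rewrite !andbT allrel_catr; apply/andP; split; last first.
  by apply/allrelP => x y /a_gt0 ? /nseqP[->].
apply/andP; split; first by apply/allrelP => x y /nseqP[-> _] /a_le.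
by apply/allrelP => x y /nseqP[-> _] /nseqP[->].
Qed.

(** The factor [t.+1] keeps the parts positive for every [t], including 0. *)
Lemma is_intpart_scale (t : nat) (lam : intpart) :
  is_intpart [seq t.+1 * x | x <- lam].
Proof.
case: lam => s /= /andP[s_sorted /allP s_gt0]; apply/andP; split.
  by apply: homo_sorted s_sorted => x y /= yx; rewrite leq_mul2l yx orbT.
by apply/allP => _ /mapP[x /s_gt0 x_gt0 ->]; rewrite muln_gt0.
Qed.

Definition scale (t : nat) (lam : intpart) : intpart :=
  IntPart (is_intpart_scale t lam).

Lemma psize_scale (t : nat) (lam : intpart) :
  psize (scale t lam) = t.+1 * psize lam.
Proof. by rewrite /psize /= big_map big_distrr. Qed.

(** Scaling multiplies each paired product by [t.+1 ^ 2] and the product of all [2 * j] parts by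
    [(t.+1 ^ 2) ^ j], so the criterion applies with [t.+1 ^ 2 * c] in place of [c]. *)
Lemma pre_scale_eq (j c t : nat) (lam mu : intpart) :
  0 < c -> size lam = 2 * j -> size mu = 2 * j ->
  all2 (fun x y => x * y == c) lam (rev mu) -> \prod_(x <- lam) x = c ^ j ->
  pre j (scale t lam) = pre j (scale t mu).
Proof.
move=> c_gt0 sz_l sz_m lm prod_l; apply: pre_eq.
apply: (@perm_pre_products _ (t.+1 ^ 2 * c)); rewrite ?size_map //.
- by rewrite muln_gt0 expn_gt0.
- rewrite /= -map_rev; elim: (parts lam) (rev mu) lm => [|x s IHs] [|y r] //=.
  by move=> /andP[/eqP xy /IHs ->]; rewrite mulnACA xy eqxx.
- rewrite big_map big_split /= prod_l big_const_seq count_predT sz_l iter_muln_1.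
  by rewrite expnMn -expnM.
Qed.

Definition lam0 (k : nat) : intpart :=
  IntPart (@is_intpart_pad k [:: 32; 32; 10; 10; 10; 4] isT isT).

Definition mu0 (k : nat) : intpart :=
  IntPart (@is_intpart_pad k [:: 40; 16; 16; 16; 5; 5] isT isT).

Lemma size_pad (k : nat) (a : seq nat) : size (pad k a) = size a + 2 * k.
Proof. by rewrite !size_cat !size_nseq addnCA mul2n addnn. Qed.

Lemma all2_lam0_mu0 (k : nat) :
  all2 (fun x y => x * y == 160) (lam0 k) (rev (mu0 k)).
Proof.
have all2_nseq x y : x * y == 160 ->
    all2 (fun x y => x * y == 160) (nseq k x) (nseq k y).
  by move=> xy; elim: k => //= k ->; rewrite xy.
have all2_cat (s1 s2 r1 r2 : seq nat) :
    all2 (fun x y => x * y == 160) s1 r1 ->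
    all2 (fun x y => x * y == 160) s2 r2 ->
    all2 (fun x y => x * y == 160) (s1 ++ s2) (r1 ++ r2).
  by elim: s1 r1 => [|x s1 IHs] [|y r1] //= /andP[-> /IHs].
rewrite /= /pad !rev_cat !rev_nseq -catA.
by apply: (all2_cat); last apply: (all2_cat); rewrite ?all2_nseq.
Qed.

Lemma prod_lam0 (k : nat) : \prod_(x <- lam0 k) x = 160 ^ (3 + k).
Proof.
rewrite /= !big_cat !big_nseq !iter_muln_1 exp1n /= muln1 mulnC expnD.
(* [lia] avoids evaluating 160 ^ 3 in unary. *)
by rewrite !big_cons big_nil !expnS; lia.
Qed.

Theorem theorem1p2 (j : nat) (hj : 3 <= j) :
  infinite_set [set p : intpart * intpart |
    [/\ p.1 <> p.2,
        size p.1 = 2 * j,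
        size p.2 = 2 * j,
        psize p.1 = psize p.2
      & pre j p.1 = pre j p.2]].
Proof.
rewrite -(subnKC hj); move: (j - 3) => k {j hj}.
have psize_eq : psize (lam0 k) = psize (mu0 k).
  by rewrite /psize /= !big_cat !big_cons !big_nil.
have psize_gt0 : 0 < psize (lam0 k).
  by rewrite /psize /= !big_cat !big_cons /=; lia.
(* The positive size of [lam0 k] is multiplied by [t.+1], so the size of the first component
   determines [t]. *)
pose f t := (scale t (lam0 k), scale t (mu0 k)).
have f_inj : injective f.
  move=> t u /(congr1 (fun p => psize p.1)) /=; rewrite !psize_scale => /eqP.
  by rewrite eqn_pmul2r // => /eqP[].
(* If the set were finite, so would be its preimage under the injective [f], which is all of
   [nat]. *)
apply: contra_not infinite_nat => /(finite_preimage (in2W f_inj)).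
congr finite_set; apply/seteqP; split=> // t _ /=.
split; rewrite ?size_map ?size_pad ?mulnDr ?psize_scale ?psize_eq //.
(* Index [k] is the first one after the 160s, where the entries are [t.+1 * 32] and [t.+1 * 40]. *)
- move=> /(congr1 (fun lam : intpart => nth 0 lam k)) /=.
  rewrite !(nth_map 0) ?size_pad /=; [|lia..].
  by rewrite /pad !nth_cat size_nseq ltnn subnn /=; lia.
- apply: (@pre_scale_eq _ 160) => //=; rewrite ?size_pad ?mulnDr //.
    exact: all2_lam0_mu0.
  exact: prod_lam0.
Qed.
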